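(* Let $W \in \mathbb{R}^{s\times m}$, $q \in \mathbb{R}^m$, and let $\mu$ be a Borel probability measure on $\mathbb{R}^s$. Assume: (A1) For every $t \in \mathbb{R}^s$ there exists some $y \in \mathbb{R}^m$, $y \geq 0$, with $Wy = t$. (A2) There exists some $\xi \in \mathbb{R}^s$ with $W^\top \xi < q$ (componentwise strict inequality). (A3) $\int_{\mathbb{R}^s} \|z\| \,\mu(\mathrm{d}z) < \infty$. (A4) $\mu$ has a density $\theta$ with respect to Lebesgue measure on $\mathbb{R}^s$, and $V \subset \mathbb{R}^s$ is a convex open set for which there are constants $r, \rho > 0$ such that $\theta \geq r$ Lebesgue-almost everywhere on $V + B_\rho(0)$. (A5) For every $x \in \mathbb{R}^s$, the set $\{ z \in \mathbb{R}^s \mid \varphi(z-x) = 0 \}$ has $\mu$-measure zero, where $\varphi(t) := \min\{ q^\top y \mid Wy = t,\ y \geq 0 \}$. Then there exists some $c > 0$ such that for every real $\eta < c$ the function $$Q_{EE}(x) := \int_{\mathbb{R}^s} \max\{ \eta, \varphi(z-x) \}\, \mu(\mathrm{d}z)$$ (the expected excess over target $\eta$) is strongly convex on $V$.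
   Context: $\|\cdot\|$ is the Euclidean norm and $B_\rho(0)$ the open ball of radius $\rho$ centered at $0$ in $\mathbb{R}^s$; vector inequalities are componentwise. Under (A1) and (A2) the function $\varphi$ is finite on all of $\mathbb{R}^s$, and under (A1)-(A3) $Q_{EE}$ is well defined, real-valued and convex on $\mathbb{R}^s$. A function $f$ is strongly convex on a convex set $V$ if there exists $\kappa > 0$ such that for all $x, x' \in V$ and all $\lambda \in [0,1]$, $$f(\lambda x' + (1-\lambda) x) \leq \lambda f(x') + (1-\lambda) f(x) - \frac{\kappa}{2} \lambda(1-\lambda) \|x'-x\|^2.$$ *)

(* Defs.v *)
From HB Require Import structures.
From mathcomp Require Import all_boot all_order all_algebra.
From mathcomp Require Import all_classical all_reals all_analysis.
From mathcomp Require Import measurable_realfun.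

Set Implicit Arguments.
Unset Strict Implicit.
Unset Printing Implicit Defensive.

Import Order.TTheory GRing.Theory Num.Theory.
Import numFieldNormedType.Exports.

Local Open Scope classical_set_scope.
Local Open Scope ring_scope.

(* The library norm on matrices is the sup norm, hence a separate definition. *)
Definition enorm (R : realType) (s : nat) (x : 'cV[R]_s) : R :=
  Num.sqrt (\sum_i x i 0 ^+ 2).

Definition eball0 (R : realType) (s : nat) (rho : R) : set 'cV[R]_s :=
  [set x | enorm x < rho].

(* R^s with its Borel sigma-algebra; the underlying type is 'cV[R]_s, so that
   topology and vector space operations remain available. *)
Definition borelRn (R : realType) (s : nat) : measurableType _ :=
  g_sigma_algebraType (@open 'cV[R]_s).

Definition cons_cV (R : realType) (s : nat) (p : R * 'cV[R]_s) : 'cV[R]_s.+1 :=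
  col_mx (const_mx p.1 : 'cV[R]_1) p.2.

(* s-fold product of the one-dimensional Lebesgue measure. *)
Fixpoint lebesgueRn (R : realType) (s : nat) : set (borelRn R s) -> \bar R :=
  if s is s'.+1 return set (borelRn R s) -> \bar R then
    pushforward (lebesgue_measure \x @lebesgueRn R s')%E
      (@cons_cV R s' : measurableTypeR R * borelRn R s' -> borelRn R s'.+1)
  else dirac ((0 : 'cV[R]_0) : borelRn R 0).
Arguments lebesgueRn : clear implicits.

Section lebesgueRn_measure.
Variable R : realType.

Lemma measurable_coord s (i : 'I_s) :
  measurable_fun [set: borelRn R s] (fun x : borelRn R s => (x : 'cV[R]_s) i 0 : R).
Proof.
apply: (measurability _ (RGenOpens.measurableE R)) => _ [_ [a [b ->]] <-].
rewrite setTI; apply: sub_sigma_algebra.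
apply: (@open_comp _ _ (fun x : 'cV[R]_s => x i 0)).
  by move=> x _; exact: coord_continuous.
exact: interval_open.
Qed.

Lemma measurable_fun_borelRn d (T : measurableType d) s (f : T -> borelRn R s) :
  (forall i, measurable_fun [set: T] (fun t => (f t : 'cV[R]_s) i 0 : R)) ->
  measurable_fun [set: T] f.
Proof.
move=> mf; apply: (@measurability _ _ T (borelRn R s) setT f (@open 'cV[R]_s) erefl).
move=> _ [U oU <-]; rewrite setTI.
pose box (p : 'cV[rat]_s * 'cV[rat]_s) : set 'cV[R]_s :=
  [set x | forall i, x i 0 \in `](ratr (p.1 i 0)), (ratr (p.2 i 0))[].
pose F p := if pselect (box p `<=` U) then f @^-1` (box p) else set0.
have -> : f @^-1` U = \bigcup_p F p.
  apply/seteqP; split => [t /= Uft|t [p _]]; last first.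
    by rewrite /F; by case: pselect => //= sU pt; exact: (sU _ pt).
  have /nbhs_ballP[e /= e0 eU] : nbhs (f t : 'cV[R]_s) U by exact: open_nbhs_nbhs.
  pose a (i : 'I_s) : R := (f t : 'cV[R]_s) i 0.
  have ha i : {q | ratr q \in `](a i - e), (a i)[}.
    by apply/cid/rat_in_itvoo; rewrite ltrBlDr ltrDl.
  have hb i : {q | ratr q \in `](a i), (a i + e)[}.
    by apply/cid/rat_in_itvoo; rewrite ltrDl.
  exists (\col_i sval (ha i), \col_i sval (hb i)) => //.
  rewrite /F; case: pselect => [? |].
    move=> i /=; rewrite !mxE; case: (ha i) (hb i) => p /= hp [q /= hq].
    move: hp hq; rewrite !in_itv/= => /andP[_ hp] /andP[hq _].
    by rewrite hp hq.
  case=> x /= xbox; apply: eU; split => // i j; rewrite ord1.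
  move: (xbox i); rewrite !mxE; case: (ha i) (hb i) => p /= hp [q /= hq].
  move: hp hq; rewrite !in_itv/= => /andP[pa _] /andP[_ qb] /andP[px xq].
  rewrite /ball/= ltr_distlC; apply/andP; split.
    exact: lt_trans pa px.
  exact: lt_trans xq qb.
apply: countable_bigcupT_measurable => // p; rewrite /F; case: pselect => ?; last exact: measurable0.
have -> : f @^-1` box p =
    \bigcap_(i in [set: 'I_s]) (fun t => (f t : 'cV[R]_s) i 0) @^-1`
      `](ratr (p.1 i 0)), (ratr (p.2 i 0))[%classic.
  by apply/seteqP; split => [t bt i _|t bt i]; [exact: bt|exact: (bt i I)].
apply: fin_bigcap_measurable => // i _.
by rewrite -[X in measurable X]setTI; exact: mf.
Qed.

Lemma cons_cV0 s (p : R * 'cV[R]_s) : cons_cV p ord0 0 = p.1.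
Proof.
rewrite /cons_cV (_ : ord0 = lshift s (ord0 : 'I_1)); last exact: val_inj.
by rewrite (@col_mxEu _ 1) mxE.
Qed.

Lemma cons_cVS s (p : R * 'cV[R]_s) (i : 'I_s) :
  cons_cV p (lift ord0 i) 0 = p.2 i 0.
Proof.
rewrite /cons_cV (_ : lift ord0 i = rshift 1 i); last exact: val_inj.
by rewrite (@col_mxEd _ 1).
Qed.

Lemma measurable_cons_cV s : measurable_fun [set: measurableTypeR R * borelRn R s]
  (@cons_cV R s : measurableTypeR R * borelRn R s -> borelRn R s.+1).
Proof.
apply: measurable_fun_borelRn => i.
have [j ->|->] := unliftP ord0 i.
  by under eq_fun do rewrite cons_cVS; exact: (measurableT_comp (measurable_coord _)).
by under eq_fun do rewrite cons_cV0; exact: measurable_fst.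
Qed.

Lemma measurable_uncons_cV s : measurable_fun [set: borelRn R s.+1]
  ((fun x : 'cV[R]_s.+1 => (x ord0 0, \col_i x (lift ord0 i) 0)) :
    borelRn R s.+1 -> measurableTypeR R * borelRn R s).
Proof.
apply/measurable_fun_pairP; split; first exact: measurable_coord.
apply: measurable_fun_borelRn => i /=.
by under eq_fun do rewrite mxE; exact: measurable_coord.
Qed.

Section step.
Variables (s : nat) (m : {sigma_finite_measure set (borelRn R s) -> \bar R}).

Let c : measurableTypeR R * borelRn R s -> borelRn R s.+1 := @cons_cV R s.
Let u : borelRn R s.+1 -> measurableTypeR R * borelRn R s :=
  fun x : 'cV[R]_s.+1 => (x ord0 0, \col_i x (lift ord0 i) 0).
Let m' : set (borelRn R s.+1) -> \bar R :=
  pushforward (lebesgue_measure \x m)%E c.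

Let cK : cancel c u.
Proof.
move=> [x v]; rewrite /u /c cons_cV0; congr pair.
by apply/colP => i; rewrite mxE cons_cVS.
Qed.

Let mc : measurable_fun setT c := @measurable_cons_cV s.
Let mu : measurable_fun setT u := @measurable_uncons_cV s.

Let m'0 : m' set0 = 0%E.
Proof. by rewrite /m' /pushforward preimage_set0 measure0. Qed.

Let m'_ge0 A : (0 <= m' A)%E.
Proof. exact: integral_ge0. Qed.

Let m'_sigma_additive : semi_sigma_additive m'.
Proof.
exact: (@measure_semi_sigma_additive _ _ _
  (pushforward (lebesgue_measure \x m)%E c)).
Qed.

HB.instance Definition _ := isMeasure.Build _ _ _ m' m'0 m'_ge0 m'_sigma_additive.

Let m'_sigma_finite : sigma_finite setT m'.
Proof.
have /sigma_finiteP[F [TF ndF Foo]] := sigma_finiteT (@lebesgue_measure R).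
have /sigma_finiteP[G [TG ndG Goo]] := sigma_finiteT m.
exists (fun n => u @^-1` (F n `*` G n)).
  apply/seteqP; split => // x _.
  have [n _ Fn] : (\bigcup_n F n) (u x).1 by rewrite -TF.
  have [k _ Gk] : (\bigcup_n G n) (u x).2 by rewrite -TG.
  exists (maxn n k) => //; split.
    by move: (u x).1 Fn; exact/subsetPset/ndF/leq_maxl.
  by move: (u x).2 Gk; exact/subsetPset/ndG/leq_maxr.
move=> n; have [mF Fn] := Foo n; have [mG Gn] := Goo n; split.
  by rewrite -[X in measurable X]setTI; apply: mu => //; exact: measurableX.
rewrite /m' /pushforward -comp_preimage (_ : u \o c = id); last first.
  by apply/funext => p; exact: cK.
by rewrite preimage_id product_measure1E// lte_mul_pinfty// ge0_fin_numE.
Qed.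

HB.instance Definition _ :=
  Measure_isSigmaFinite.Build _ _ _ m' m'_sigma_finite.

Definition lebesgueRn_step :
  {sigma_finite_measure set (borelRn R s.+1) -> \bar R} := m'.

End step.

Lemma lebesgueRn_sigma_finite_measure s :
  exists m : {sigma_finite_measure set (borelRn R s) -> \bar R},
    lebesgueRn R s = m.
Proof.
elim: s => [|s [m IH]]; first by exists (dirac ((0 : 'cV[R]_0) : borelRn R 0)).
by exists (lebesgueRn_step m); rewrite /= IH.
Qed.

Section instances.
Variable s : nat.

Let lebesgueRn0 : lebesgueRn R s set0 = 0%E.
Proof. by have [m ->] := lebesgueRn_sigma_finite_measure s; exact: measure0. Qed.

Let lebesgueRn_ge0 A : (0 <= lebesgueRn R s A)%E.
Proof. by have [m ->] := lebesgueRn_sigma_finite_measure s. Qed.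

Let lebesgueRn_sigma_additive : semi_sigma_additive (lebesgueRn R s).
Proof.
have [m ->] := lebesgueRn_sigma_finite_measure s.
exact: measure_semi_sigma_additive.
Qed.

HB.instance Definition _ := isMeasure.Build _ _ _ (lebesgueRn R s)
  lebesgueRn0 lebesgueRn_ge0 lebesgueRn_sigma_additive.

Let lebesgueRn_sigma_finite : sigma_finite setT (lebesgueRn R s).
Proof.
by have [m ->] := lebesgueRn_sigma_finite_measure s; exact: sigma_finiteT.
Qed.

HB.instance Definition _ := Measure_isSigmaFinite.Build _ _ _ (lebesgueRn R s)
  lebesgueRn_sigma_finite.

End instances.

Lemma lebesgueRn_box s (a b : 'cV[R]_s) : (forall i, a i 0 <= b i 0) ->
  lebesgueRn R s [set x : 'cV[R]_s | forall i, x i 0 \in `[a i 0, b i 0]] =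
  (\prod_i (b i 0 - a i 0))%:E.
Proof.
elim: s a b => [|s IH] a b ab.
  by rewrite big_ord0 /= diracE mem_set//= => -[].
pose a' : 'cV[R]_s := \col_i a (lift ord0 i) 0.
pose b' : 'cV[R]_s := \col_i b (lift ord0 i) 0.
rewrite big_ord_recl EFinM /= /pushforward.
have -> : @cons_cV R s @^-1`
      [set x : 'cV[R]_s.+1 | forall i, x i 0 \in `[a i 0, b i 0]] =
    `[a ord0 0, b ord0 0]%classic `*`
      [set x : 'cV[R]_s | forall i, x i 0 \in `[a' i 0, b' i 0]].
  apply/seteqP; split => [p /= pab|p /= [p1 p2] i].
    split; first by have := pab ord0; rewrite cons_cV0.
    by move=> i; have := pab (lift ord0 i); rewrite cons_cVS !mxE.
  have [j ->|->] := unliftP ord0 i; last by rewrite cons_cV0.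
  by have := p2 j; rewrite cons_cVS !mxE.
rewrite product_measure1E//.
- congr (_ * _)%E.
    apply: etrans (lebesgue_measure_itv _) _; rewrite /= lte_fin.
    by have := ab ord0; rewrite le_eqVlt => /predU1P[->|->//]; rewrite ltxx subrr.
  apply: etrans (IH a' b' _) _ => [i|]; first by rewrite !mxE.
  by congr EFin; apply: eq_bigr => i _; rewrite !mxE.
- rewrite (_ : mkset _ = \bigcap_(i in [set: 'I_s])
      (fun x : borelRn R s => (x : 'cV[R]_s) i 0) @^-1` `[a' i 0, b' i 0]%classic).
    apply: fin_bigcap_measurable => // i _.
    by rewrite -[X in measurable X]setTI; exact: measurable_coord.
  by apply/seteqP; split => [x xab i _|x xab i]; [exact: xab|exact: (xab i I)].
Qed.

End lebesgueRn_measure.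

Section recourse.
Variables (R : realType) (s m : nat) (q : 'cV[R]_m) (W : 'M[R]_(s, m)).

Definition feasible (t : 'cV[R]_s) : set 'cV[R]_m :=
  [set y | W *m y = t /\ forall j, 0 <= y j 0].

(* The minimum of q^T y over the feasible y; an arbitrary real if the minimum
   is not attained. *)
Definition phi (t : 'cV[R]_s) : R :=
  let values := [set (q^T *m y) 0 0 | y in feasible t] in
  get [set v | values v /\ lbound values v].

Definition expected_excess (mu : probability (borelRn R s) R) (eta : R)
    (x : 'cV[R]_s) : R :=
  \int[mu]_z Num.max eta (phi ((z : 'cV[R]_s) - x)).

End recourse.

Definition has_density (R : realType) (s : nat)
    (mu : probability (borelRn R s) R) (theta : borelRn R s -> R) : Prop :=
  [/\ measurable_fun [set: borelRn R s] theta,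
      forall z, 0 <= theta z &
      forall A, measurable A ->
        mu A = (\int[lebesgueRn R s]_(z in A) (theta z)%:E)%E].

Definition strongly_convex (R : realType) (s : nat) (V : set 'cV[R]_s)
    (f : 'cV[R]_s -> R) : Prop :=
  exists kappa : R, 0 < kappa /\
    forall (x x' : 'cV[R]_s) (lambda : R), V x -> V x' -> 0 <= lambda <= 1 ->
      f (lambda *: x' + (1 - lambda) *: x) <=
        lambda * f x' + (1 - lambda) * f x
        - kappa / 2 * lambda * (1 - lambda) * enorm (x' - x) ^+ 2.

(* Main.v *)
Require Import Defs.
From mathcomp Require Import all_boot all_order all_algebra.
From mathcomp Require Import all_classical all_reals all_analysis.
From mathcomp Require Import measurable_realfun ring lra.

Import Order.TTheory GRing.Theory Num.Theory.
Import numFieldNormedType.Exports.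

Local Open Scope classical_set_scope.
Local Open Scope ring_scope.

Set Implicit Arguments.
Unset Strict Implicit.

(* Write [f = max(eta, phi)] and [D_h f(t) = f(t+h) + f(t-h) - 2 f(t) >= 0].
   The recourse function [phi] is sublinear and, by (A2),
   [phi(h) + phi(-h) >= 2 k |h|].  Hence on the line spanned by [h] the function
   [f] has a kink of size [k |h|] at distance at most [max(eta, 0) / k] from the
   origin, which is less than the radius available from (A4) once [eta < c].
   So the integral of [D_h f] over a cube is bounded below at a macroscopic
   scale of [h].  The identity
     [D_{2h} f(t) = D_h f(t+h) + 2 D_h f(t) + D_h f(t-h)]
   and translation invariance of Lebesgue measure carry this bound to all
   smaller scales, losing a factor 4 at each halving of [h]: the integral is at
   least [c |h|^2].  The convexity gap of [f] dominates a multiple of [D_{al h} f]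
   pointwise, and integrating against [mu >= r Leb] near [V] gives strong
   convexity, [V] being bounded because of (A3) and (A4).  Here [|.|] is the sup
   norm of the library. *)

(** * Sup norm and recourse function *)

Section norms.
Context {R : realType}.

Lemma ler_mx_norm m n (x : 'M[R]_(m, n)) (a : R) : 0 <= a ->
  `|x| <= a <-> forall i j, `|x i j| <= a.
Proof.
move=> a0; rewrite [`|x|]/Num.Def.normr/= mx_normrE; split=> [xa i j|xa].
  apply: le_trans xa.
  exact: (le_bigmax _ (fun ij : 'I_m * 'I_n => `|x ij.1 ij.2|) (i, j)).
by apply/bigmax_leP; split => // -[i j] _ /=.
Qed.

Lemma le_coord_norm m n (x : 'M[R]_(m, n)) i j : `|x i j| <= `|x|.
Proof. exact: ((ler_mx_norm x (normr_ge0 x)).1 (lexx _)). Qed.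

Lemma norm_le_enorm s (x : 'cV[R]_s) : `|x| <= enorm x.
Proof.
apply/ler_mx_norm => [|i j]; first exact: sqrtr_ge0.
rewrite ord1 -sqrtr_sqr ler_wsqrtr// (bigD1 i)//= lerDl.
by apply: sumr_ge0 => k _; exact: sqr_ge0.
Qed.

Lemma enorm_sqr_le s (x : 'cV[R]_s) : enorm x ^+ 2 <= s%:R * `|x| ^+ 2.
Proof.
rewrite /enorm sqr_sqrtr; last by apply: sumr_ge0 => i _; exact: sqr_ge0.
apply: (@le_trans _ _ (\sum_(i < s) `|x| ^+ 2)).
  apply: ler_sum => i _; rewrite -(real_normK (num_real (x i 0))).
  by rewrite lerXn2r ?nnegrE// le_coord_norm.
by rewrite sumr_const card_ord mulr_natl.
Qed.

End norms.

Section dual_gap.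
Context {R : realType} {s m : nat}.
Variables (W : 'M[R]_(s, m)) (q : 'cV[R]_m).

Definition dotp n (x y : 'cV[R]_n) : R := (x^T *m y) 0 0.

Lemma dotpE n (x y : 'cV[R]_n) : dotp x y = \sum_i x i 0 * y i 0.
Proof. by rewrite /dotp mxE; apply: eq_bigr => i _; rewrite mxE. Qed.

Lemma dotpDr n (x y z : 'cV[R]_n) : dotp x (y + z) = dotp x y + dotp x z.
Proof. by rewrite /dotp mulmxDr mxE. Qed.

Lemma dotpZr n (x y : 'cV[R]_n) a : dotp x (a *: y) = a * dotp x y.
Proof. by rewrite /dotp -scalemxAr mxE. Qed.

(** The slack [q - W^T xi] has finitely many coordinates, all positive, so it is bounded below by
    some [d > 0]; pair it with [y >= 0]. *)
Lemma strictly_dual_feasible_gap (xi : 'cV[R]_s) :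
  (forall j, (W^T *m xi) j 0 < q j 0) ->
  exists2 d : R, 0 < d & forall y : 'cV[R]_m, (forall j, 0 <= y j 0) ->
    dotp xi (W *m y) + d * (\sum_j y j 0) <= dotp q y.
Proof.
move=> xiq.
pose g (j : 'I_m) : R := q j 0 - (W^T *m xi) j 0.
(* The default value 1 keeps the minimum positive even when [m = 0]. *)
exists (\big[Order.min/1]_j g j).
  by apply/lt_bigmin => // j _; rewrite subr_gt0.
move=> y y0.
have -> : dotp xi (W *m y) = dotp (W^T *m xi) y.
  by rewrite /dotp mulmxA trmx_mul trmxK.
rewrite !dotpE mulr_sumr -big_split/=; apply: ler_sum => j _.
rewrite -mulrDl ler_wpM2r// -lerBrDl.
exact: bigmin_le.
Qed.

Lemma norm_mulmx_le (y : 'cV[R]_m) : (forall j, 0 <= y j 0) ->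
  `|W *m y| <= `|W| * \sum_j y j 0.
Proof.
move=> y0; apply/ler_mx_norm => [|i k].
  by rewrite mulr_ge0// sumr_ge0// => j _.
rewrite ord1 mxE; apply: le_trans (ler_norm_sum _ _ _) _.
rewrite mulr_sumr; apply: ler_sum => j _.
by rewrite normrM (ger0_norm (y0 j)) ler_wpM2r// le_coord_norm.
Qed.

End dual_gap.
(** Row vectors are used because the compactness and extreme value theorems applied in
    [phi_attained] are stated for them. *)
Lemma continuous_mulmx_row (R : realType) m n (M : 'M[R]_(n, m)) i :
  continuous (fun v : 'rV[R]_m => (M *m v^T) i 0).
Proof.
rewrite (_ : (fun _ => _) = fun v : 'rV[R]_m => \sum_j M i j * v 0 j); last first.
  by apply/funext => v; rewrite mxE; apply: eq_bigr => j _; rewrite mxE.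
elim: (index_enum _) => [|j r IH] v.
  rewrite (_ : (fun _ => _) = cst 0); first exact: cst_continuous.
  by apply/funext => u; rewrite big_nil.
rewrite (_ : (fun _ => _) = fun u : 'rV[R]_m =>
    M i j * u 0 j + \sum_(k <- r) M i k * u 0 k); last first.
  by apply/funext => u; rewrite big_cons.
apply: cvgD (IH v).
by apply: cvgM; [exact: cvg_cst|exact: coord_continuous].
Qed.

Section attainment.
Context {R : realType} {s m : nat}.
Variables (W : 'M[R]_(s, m)) (q : 'cV[R]_m).
Hypothesis A1 : forall t : 'cV[R]_s,
  exists y : 'cV[R]_m, (forall j, 0 <= y j 0) /\ W *m y = t.
Hypothesis A2 : exists xi : 'cV[R]_s, forall j, (W^T *m xi) j 0 < q j 0.

(** The feasible points that cost no more than a given feasible [y0] form a compact set: the dual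
    gap bounds the sum of their coordinates. The continuous cost attains its minimum there. *)
Lemma phi_attained (t : 'cV[R]_s) : exists y : 'cV[R]_m,
  [/\ feasible W t y, phi q W t = dotp q y &
    forall y', feasible W t y' -> phi q W t <= dotp q y'].
Proof.
have [y0 [y00 Wy0]] := A1 t; have [xi /strictly_dual_feasible_gap[d d0 gap]] := A2.
pose A : set 'rV[R]_m :=
  [set v | [/\ forall i, (W *m v^T) i 0 = t i 0, forall j, 0 <= v 0 j &
             (q^T *m v^T) 0 0 <= dotp q y0]].
have bA : bounded_set A.
  exists ((dotp q y0 - dotp xi t) / d); split; first exact: num_real.
  move=> M ltM v [Wv v0 qv].
  have WvE : W *m v^T = t by apply/colP => i; rewrite Wv.
  have v0' j : 0 <= v^T j 0 by rewrite mxE.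
  have sumv : \sum_j v^T j 0 <= (dotp q y0 - dotp xi t) / d.
    rewrite ler_pdivlMr// mulrC lerBrDl -WvE; apply: le_trans (gap _ v0') _.
    exact: qv.
  have M0 : 0 <= M.
    by apply: le_trans (ltW ltM); apply: le_trans sumv; exact: sumr_ge0.
  apply/ler_mx_norm => // i j; rewrite ord1 ger0_norm//.
  apply: le_trans (ltW ltM); apply: le_trans sumv.
  rewrite (bigD1 j)//= mxE lerDl; exact: sumr_ge0.
have cA : closed A.
  have -> : A = (\bigcap_(i in setT) (fun v : 'rV[R]_m => (W *m v^T) i 0) @^-1` [set t i 0])
     `&` ((\bigcap_(j in setT) (fun v : 'rV[R]_m => v 0 j) @^-1` [set x | 0 <= x])
     `&` (fun v : 'rV[R]_m => (q^T *m v^T) 0 0) @^-1` [set x | x <= dotp q y0]).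
    apply/seteqP; split=> [v [h1 h2 h3]|v [h1 [h2 h3]]].
      by split=> [i _|]; [exact: h1|split=> [j _|]; [exact: h2|exact: h3]].
    by split=> // [i|j]; [exact: h1|exact: h2].
  apply: closedI; last apply: closedI.
  - apply: closed_bigI => i _; apply: preimage_closed.
      by move=> v _; exact: continuous_mulmx_row.
    exact: closed_eq.
  - apply: closed_bigI => j _; apply: preimage_closed.
      by move=> v _; exact: coord_continuous.
    exact: closed_ge.
  - apply: preimage_closed; first by move=> v _; exact: continuous_mulmx_row.
    exact: closed_le.
have A0 : A !=set0 by exists y0^T; split=> [i|j|]; rewrite ?trmxK ?Wy0// mxE.
have ctsq : {within A, continuous (fun v : 'rV[R]_m => (q^T *m v^T) 0 0)}.
  by apply: continuous_subspaceT => v; exact: continuous_mulmx_row.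
have [v] := EVT_min_rV A0 (bounded_closed_compact bA cA) ctsq.
rewrite inE => -[Wv v0 qv] vmin.
have fv : feasible W t v^T.
  by split=> [|j]; [apply/colP => i; rewrite Wv|rewrite mxE].
(* A feasible point outside [A] costs more than [y0], hence more than [v]. *)
have vmin' y' : feasible W t y' -> dotp q v^T <= dotp q y'.
  move=> [Wy' y'0]; have [qy'|qy'] := leP (dotp q y') (dotp q y0); last first.
    exact: le_trans qv (ltW qy').
  have := vmin y'^T; rewrite trmxK; apply; rewrite inE.
  by split=> [i|j|]; rewrite ?trmxK ?Wy'// mxE.
(* [phi] is a choice made by [get]; the minimizer [v] shows that its defining predicate is
   inhabited, so the chosen value satisfies it. *)
have := @getPex _ [set w | [set dotp q y | y in feasible W t] w /\
                 lbound [set dotp q y | y in feasible W t] w].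
case.
  exists (dotp q v^T); split; first by exists v^T.
  by move=> _ [y' fy' <-]; exact: vmin'.
move=> -[y fy qy] lb; exists y; split => //.
by move=> y' fy'; apply: lb; exists y'.
Qed.

Lemma phi_le (y : 'cV[R]_m) : (forall j, 0 <= y j 0) -> phi q W (W *m y) <= dotp q y.
Proof. by move=> y0; have [_ [_ _]] := phi_attained (W *m y); exact. Qed.

Lemma phiD t u : phi q W (t + u) <= phi q W t + phi q W u.
Proof.
have [y [[<- y0] -> _]] := phi_attained t; have [y' [[<- y'0] -> _]] := phi_attained u.
rewrite -dotpDr -mulmxDr; apply: phi_le => j.
by rewrite mxE addr_ge0.
Qed.

Lemma phiZ_le a t : 0 <= a -> phi q W (a *: t) <= a * phi q W t.
Proof.
move=> a0; have [y [[<- y0] -> _]] := phi_attained t.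
rewrite -dotpZr scalemxAr; apply: phi_le => j.
by rewrite mxE mulr_ge0.
Qed.

(** For an optimal [y], the dual gap gives the surplus [d * \sum_j y j 0], and this sum controls the
    norm of [t = W *m y]. Adding 1 to the norm of [W] avoids a zero denominator. *)
Lemma phi_coercive : exists xi : 'cV[R]_s, exists2 k, 0 < k &
  forall t, dotp xi t + k * `|t| <= phi q W t.
Proof.
have [xi /strictly_dual_feasible_gap[d d0 gap]] := A2; exists xi.
exists (d / (`|W| + 1)); first by rewrite divr_gt0// ltr_wpDl.
move=> t; have [y [[<- y0] -> _]] := phi_attained t.
apply: le_trans (gap _ y0); rewrite lerD2l mulrAC ler_pdivrMr ?ltr_wpDl//.
rewrite -mulrA ler_pM2l// mulrDr mulr1 mulrC.
by apply: le_trans (norm_mulmx_le W y0) _; rewrite mulrC lerDl sumr_ge0.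
Qed.

Lemma phi0 : phi q W 0 = 0.
Proof.
apply/eqP; rewrite eq_le; apply/andP; split.
  by have := @phiZ_le 0 0 (lexx _); rewrite scaler0 mul0r.
have [xi [k k0 /(_ 0)]] := phi_coercive.
by rewrite normr0 mulr0 addr0 /dotp mulmx0 mxE.
Qed.

Lemma phiZ a t : 0 < a -> phi q W (a *: t) = a * phi q W t.
Proof.
move=> a0; apply/eqP; rewrite eq_le phiZ_le ?(ltW a0)//=.
rewrite -ler_pdivlMl//; apply: le_trans (phiZ_le _ _); last by rewrite invr_ge0 ltW.
by rewrite scalerA mulVf ?scale1r// gt_eqF.
Qed.

(** The linear parts of the coercivity bounds at [t] and [- t] cancel. *)
Lemma phi_opp_ge : exists2 k, 0 < k &
  forall t, 2 * k * `|t| <= phi q W t + phi q W (- t).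
Proof.
have [xi [k k0 H]] := phi_coercive; exists k => // t.
have := lerD (H t) (H (- t)); rewrite normrN.
have -> : dotp xi (- t) = - dotp xi t by rewrite /dotp mulmxN mxE.
lra.
Qed.

(** Expand [t] in the standard basis and use sublinearity. Homogeneity holds only for nonnegative
    factors, so both [e i] and [- e i] enter the constant. *)
Lemma phi_norm_bound : exists2 L, 0 < L & forall t, phi q W t <= L * `|t|.
Proof.
pose e (i : 'I_s) : 'cV[R]_s := delta_mx i 0.
exists (1 + \sum_i (`|phi q W (e i)| + `|phi q W (- e i)|)).
  by rewrite ltr_wpDr// sumr_ge0// => i _; rewrite addr_ge0.
move=> t.
have tE : t = \sum_i t i 0 *: e i.
  apply/colP => i; rewrite summxE (bigD1 i)//= !mxE !eqxx mulr1 big1 ?addr0// => j ji.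
  by rewrite !mxE eq_sym (negbTE ji) mulr0.
apply: (@le_trans _ _ (\sum_i phi q W (t i 0 *: e i))).
  rewrite {1}tE; elim/big_ind2 : _ => [|x1 x2 y1 y2 h1 h2|//].
    by rewrite phi0.
  by apply: le_trans (phiD _ _) _; exact: lerD.
rewrite mulrDl mul1r mulr_suml ler_wpDl//; apply: ler_sum => i _.
have ti := le_coord_norm t i 0.
have bound a u (b : R) : 0 <= a -> a <= `|t| -> `|phi q W u| <= b ->
    phi q W (a *: u) <= b * `|t|.
  move=> a0 at_ ub; apply: le_trans (phiZ_le _ a0) _.
  apply: le_trans (_ : _ <= a * `|phi q W u|) _; first by rewrite ler_wpM2l// ler_norm.
  by rewrite mulrC ler_pM.
have [t0|t0] := leP 0 (t i 0).
  by apply: bound => //; [rewrite ger0_norm in ti|rewrite lerDl].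
rewrite -[_ *: _]opprK -scalerN -scaleNr.
by apply: bound; [rewrite oppr_ge0 ltW|rewrite ltr0_norm in ti|rewrite lerDr].
Qed.

Lemma phi_Lipschitz : exists2 L, 0 < L &
  forall t u, `|phi q W t - phi q W u| <= L * `|t - u|.
Proof.
have [L L0 H] := phi_norm_bound; exists L => // t u.
have half t' u' : phi q W t' - phi q W u' <= L * `|t' - u'|.
  rewrite lerBlDr; apply: le_trans (_ : _ <= phi q W (t' - u') + phi q W u') _.
    by rewrite -{1}(subrK u' t'); exact: phiD.
  by rewrite lerD2r.
by rewrite ler_norml half andbT lerNl opprB distrC half.
Qed.

Lemma phi_convex t u a : 0 <= a <= 1 ->
  phi q W (a *: t + (1 - a) *: u) <= a * phi q W t + (1 - a) * phi q W u.
Proof.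
move=> /andP[a0 a1]; apply: le_trans (phiD _ _) _.
by apply: lerD; apply: phiZ_le => //; rewrite subr_ge0.
Qed.

End attainment.

(** * Second differences of convex functions *)

Section second_difference.
Context {R : realType} {s : nat}.
Implicit Types (f : 'cV[R]_s -> R) (h t : 'cV[R]_s).

Definition sdiff f h t : R := f (t + h) + f (t - h) - 2 * f t.

Definition jensen_convex f := forall x y a, 0 <= a <= 1 ->
  f (a *: x + (1 - a) *: y) <= a * f x + (1 - a) * f y.

Definition lipschitz_with (L : R) f := forall x y, `|f x - f y| <= L * `|x - y|.

Lemma sdiffN f h t : sdiff f (- h) t = sdiff f h t.
Proof. by rewrite /sdiff opprK [f (t - h) + _]addrC. Qed.

Lemma sdiff_double f h t :
  sdiff f (h + h) t = sdiff f h (t + h) + 2 * sdiff f h t + sdiff f h (t - h).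
Proof.
by rewrite /sdiff addrK subrK opprD !addrA; ring.
Qed.

Lemma sdiff_ge0 f h t : jensen_convex f -> 0 <= sdiff f h t.
Proof.
move=> cf; have h2 : 0 <= (2^-1 : R) <= 1 by lra.
have := cf (t + h) (t - h) _ h2.
rewrite (_ : 1 - 2^-1 = 2^-1 :> R); last by lra.
rewrite (_ : _ + _ *: (t - h) = t) /sdiff; first lra.
rewrite -scalerDr addrACA subrr addr0 scalerDr -scalerDl -[RHS]scale1r.
by congr (_ *: _); lra.
Qed.

(** Four values of [f] enter, the central one counted twice, and each moves by at most
    [L * |t - u|]. *)
Lemma sdiff_lipschitz f L h t u : lipschitz_with L f ->
  sdiff f h t - 4 * L * `|t - u| <= sdiff f h u.
Proof.
move=> lf.
have H v : `|f (t + v) - f (u + v)| <= L * `|t - u|.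
  by apply: le_trans (lf _ _) _; rewrite opprD addrACA subrr addr0.
have := H 0; have := H h; have := H (- h); rewrite !addr0 !ler_norml /sdiff.
lra.
Qed.

(* The left-hand side is a second difference over a step [al *: h] that is
   adjacent to [t] on the side of the farther of the two points. *)
Lemma convexity_gap_ge f t h (la al : R) : jensen_convex f ->
    0 <= la -> la <= 1 / 2 -> 0 < al -> al <= 1 / 4 ->
  la * (1 - la) / (2 * al) * sdiff f (al *: h) (t - al *: h) <=
  la * f (t - (1 - la) *: h) + (1 - la) * f (t + la *: h) - f t.
Proof.
move=> cf la0 la2 al0 al4.
(* Convexity at [t], which lies between [t - al *: h] and [t + la *: h]. *)
have i1 : (la + al) * f t <= la * f (t - al *: h) + al * f (t + la *: h).
  have lapos : 0 < la + al by rewrite ltr_wpDl.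
  have a01 : 0 <= la / (la + al) <= 1.
    by rewrite divr_ge0 ?(ltW lapos)//= ler_pdivrMr// mul1r lerDl ltW.
  have := cf (t - al *: h) (t + la *: h) _ a01.
  have -> : la / (la + al) *: (t - al *: h) + (1 - la / (la + al)) *: (t + la *: h) = t.
    by apply/colP => i; rewrite !mxE; field; rewrite gt_eqF.
  rewrite -(ler_pM2l lapos) => /le_trans; apply.
  by rewrite le_eqVlt; apply/orP; left; apply/eqP; field; rewrite gt_eqF.
(* Convexity at [t - 2 al h], which lies between [t - (1 - la) h] and [t] because
   [2 al <= 1/2 <= 1 - la]. *)
have i2 : (1 - la) * f (t - (al + al) *: h) <=
    (al + al) * f (t - (1 - la) *: h) + (1 - la - (al + al)) * f t.
  have lapos : 0 < 1 - la by lra.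
  have a01 : 0 <= (al + al) / (1 - la) <= 1.
    apply/andP; split; first by apply: divr_ge0; lra.
    by rewrite ler_pdivrMr// mul1r; lra.
  have := cf (t - (1 - la) *: h) t _ a01.
  have -> : (al + al) / (1 - la) *: (t - (1 - la) *: h) +
      (1 - (al + al) / (1 - la)) *: t = t - (al + al) *: h.
    by apply/colP => i; rewrite !mxE; field; rewrite gt_eqF.
  rewrite -(ler_pM2l lapos) => /le_trans; apply.
  by rewrite le_eqVlt; apply/orP; left; apply/eqP; field; rewrite gt_eqF.
rewrite mulrAC ler_pdivrMr ?mulr_gt0// /sdiff subrK.
rewrite -[t - al *: h - al *: h]addrA -opprD -scalerDl.
(* The claim is exactly [la] times [i2] plus [2 (1 - la)] times [i1]. *)
have := ler_wpM2l la0 i2.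
have la1 : 0 <= 2 * (1 - la) by lra.
have := ler_wpM2l la1 i1.
move: (f t) (f (t - _)) (f (t + _)) (f (t - (al + al) *: h)) (f (t - al *: h)).
move=> f0 fP fQ f2 f1 H1 H2.
nra.
Qed.

End second_difference.

(** * Truncation at a level and the resulting kink *)

Section truncation.
Context {R : realType} {s : nat}.
Variable p : 'cV[R]_s -> R.

Lemma jensen_convex_max (eta : R) : jensen_convex p -> jensen_convex (fun t => Num.max eta (p t)).
Proof.
move=> cp x y a a01; have /andP[a0 a1] := a01; rewrite ge_max; apply/andP; split.
  rewrite -{1}[eta]mul1r -{1}(subrK a 1) [1 - a + a]addrC mulrDl.
  by rewrite lerD// ler_wpM2l// ?subr_ge0// le_max lexx.
apply: le_trans (cp _ _ _ a01) _.
by rewrite lerD// ler_wpM2l// ?subr_ge0// le_max lexx orbT.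
Qed.

Lemma lipschitz_with_max (eta L : R) : lipschitz_with L p ->
  lipschitz_with L (fun t => Num.max eta (p t)).
Proof.
move=> lp x y; apply: le_trans (lp x y).
have := ler_norm (p x - p y); have := ler_norm (p y - p x).
rewrite [`|p y - _|]distrC ler_norml => H1 H2.
by rewrite /Num.max; case: ltP => h1; case: ltP => h2; lra.
Qed.

(* On the line through [h] the truncated function has a kink: at the origin if
   [eta <= 0], and where [p] reaches the level [eta] if [eta > 0]. *)
Lemma truncation_kink (k eta : R) (h : 'cV[R]_s) : 0 < k -> p 0 = 0 ->
    (forall a t, 0 < a -> p (a *: t) = a * p t) ->
    (forall t, 2 * k * `|t| <= p t + p (- t)) ->
  exists2 t0 : 'cV[R]_s, `|t0| <= Num.max eta 0 / k &
    k * `|h| <= sdiff (fun t => Num.max eta (p t)) h t0.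
Proof.
move=> k0 p0 pZ pN.
have [eta0|eta0] := leP eta 0.
  exists 0; first by rewrite normr0 mul0r.
  rewrite /sdiff add0r sub0r p0 (max_idPr eta0) mulr0 subr0.
  apply: le_trans (_ : _ <= p h + p (- h)) _.
    by apply: le_trans (pN h); rewrite ler_wpM2r// mulr2n mulrDl mul1r lerDl ltW.
  by apply: lerD; rewrite le_max lexx orbT.
(* One of [p h] and [p (- h)] is at least [k |h|], and the second difference is even in [h]. *)
wlog ph : h / k * `|h| <= p h => [H|].
  have [|ph] := leP (k * `|h|) (p h); first exact: H.
  have [|t0 t0k t0h] := H (- h).
    by have := pN h; rewrite normrN; lra.
  by exists t0 => //; rewrite sdiffN normrN in t0h.
have [->|h0] := eqVneq h 0.
  exists 0; first by rewrite normr0 divr_ge0 ?ltW.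
  by rewrite /sdiff normr0 !addr0 subr0 mulr0; lra.
have hpos : 0 < `|h| by rewrite normr_gt0.
have phpos : 0 < p h by apply: lt_le_trans ph; rewrite mulr_gt0.
have eh : 0 < eta / p h by rewrite divr_gt0.
(* By homogeneity [p] equals [eta] at this point; [p h >= k |h|] bounds its norm by [eta / k]. *)
exists ((eta / p h) *: h).
  rewrite normrZ (ger0_norm (ltW eh)) mulrAC ler_pdivrMr// mulrAC.
  by rewrite ler_pdivlMr// -mulrA ler_pM2l// mulrC.
rewrite /sdiff pZ// divfK ?gt_eqF// maxxx.
have -> : eta / p h *: h + h = (eta / p h + 1) *: h by rewrite scalerDl scale1r.
rewrite pZ; last by rewrite addr_gt0.
rewrite mulrDl mul1r divfK ?gt_eqF//.
have /max_idPr -> : eta <= eta + p h by rewrite lerDl ltW.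
(* The forward value is [eta + p h], the central one is [eta] and the backward one is at least
   [eta], so the second difference is at least [p h]. *)
have : eta <= Num.max eta (p (eta / p h *: h - h)) by rewrite le_max lexx.
move: ph; lra.
Qed.

End truncation.

(** * Lebesgue measure on R^s *)

Section borel.
Context {R : realType}.

Lemma measurable_open s (U : set (borelRn R s)) : open (U : set 'cV[R]_s) -> measurable U.
Proof. by move=> oU; exact: sub_sigma_algebra. Qed.

Lemma measurable_closed s (U : set (borelRn R s)) :
  closed (U : set 'cV[R]_s) -> measurable U.
Proof.
move=> cU; rewrite -[U]setCK; apply: measurableC; apply: measurable_open.
by rewrite openC.
Qed.

Lemma continuous_measurable s (f : 'cV[R]_s -> R) : continuous f ->
  measurable_fun [set: borelRn R s] (f : borelRn R s -> R).
Proof.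
move=> cf.
apply: (measurability _ (RGenOpens.measurableE R)) => _ [_ [a [b ->]] <-].
rewrite setTI; apply: measurable_open; apply: open_comp; last exact: interval_open.
by move=> x _; exact: cf.
Qed.

Lemma lipschitz_with_continuous s (L : R) (f : 'cV[R]_s -> R) : 0 < L ->
  lipschitz_with L f -> continuous f.
Proof.
move=> L0 lf x; apply/(@cvgrPdist_lt _ _ _ (nbhs x) (nbhs_filter x)) => e e0.
apply/nbhs_ballP; exists (e / L) => /=; first exact: divr_gt0.
move=> y; rewrite mx_norm_ball /ball_/= ltr_pdivlMr// mulrC.
by apply: le_lt_trans; exact: lf.
Qed.

Lemma lipschitz_with_measurable s (L : R) (f : 'cV[R]_s -> R) : 0 < L -> lipschitz_with L f ->
  measurable_fun [set: borelRn R s] (f : borelRn R s -> R).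
Proof. by move=> L0 lf; exact: continuous_measurable (lipschitz_with_continuous L0 lf). Qed.

Definition translate s (v : 'cV[R]_s) (x : borelRn R s) : borelRn R s := (x : 'cV[R]_s) + v.

Lemma measurable_translate s (v : 'cV[R]_s) : measurable_fun setT (translate v).
Proof.
apply: measurable_fun_borelRn => i; rewrite /translate.
under eq_fun do rewrite mxE.
by apply: measurable_funD; [exact: measurable_coord|exact: measurable_cst].
Qed.

Definition translate1 (a : R) (x : measurableTypeR R) : measurableTypeR R := (x : R) + a.

Lemma measurable_translate1 a : measurable_fun setT (translate1 a).
Proof. by apply: measurable_funD; [exact: measurable_id|exact: measurable_cst]. Qed.

Local Open Scope ereal_scope.

Lemma lebesgue_measure_translate1 (a : R) (A : set R) : measurable A ->
  lebesgue_measure (translate1 a @^-1` A) = lebesgue_measure A.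
Proof.
move=> mA; apply/esym.
(* The measure structure of a pushforward takes the measurability proof as an
   argument, hence is not inferred and has to be named. *)
pose m' : {measure set (measurableTypeR R) -> \bar R} :=
  measure_function_pushforward__canonical__measure_function_Measure
    lebesgue_measure (measurable_translate1 a).
apply: (@lebesgue_measure_unique R m') => // _ [[b c]] _ <-.
rewrite /m' /= /pushforward.
have -> : translate1 a @^-1` `]b, c]%classic = `](b - a)%R, (c - a)%R]%classic.
  by apply/seteqP; split=> x /=; rewrite /translate1 !in_itv/= ltrBlDr lerBrDr.
rewrite !lebesgue_measure_itv/= !lte_fin ltrD2r.
by rewrite -!EFinB; case: ifP => // _; congr EFin; ring.
Qed.

Definition translate_pair s (v : 'cV[R]_s.+1) (p : measurableTypeR R * borelRn R s) :
    measurableTypeR R * borelRn R s :=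
  (translate1 (v ord0 0%R) p.1, translate (\col_i v (lift ord0 i) 0%R) p.2).

Lemma measurable_translate_pair s (v : 'cV[R]_s.+1) : measurable_fun setT (translate_pair v).
Proof.
apply/measurable_fun_pairP; split => /=.
  exact: (measurableT_comp (measurable_translate1 _) measurable_fst).
exact: (measurableT_comp (measurable_translate _) measurable_snd).
Qed.

(** Induction on the dimension. Translation acts separately on the head and the tail of a vector, so
    the translated product measure agrees with the original on rectangles; uniqueness of the product
    measure concludes. *)
Lemma lebesgueRn_translate s (v : 'cV[R]_s) (A : set (borelRn R s)) : measurable A ->
  lebesgueRn R s (translate v @^-1` A) = lebesgueRn R s A.
Proof.
elim: s v A => [|s IH] v A mA.
  congr (lebesgueRn R 0 _); apply/seteqP; split=> x /=;
  by rewrite (_ : translate v x = x)//; apply/colP => -[].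
rewrite /= /pushforward.
pose m' : {measure set (measurableTypeR R * borelRn R s) -> \bar R} :=
  measure_function_pushforward__canonical__measure_function_Measure
    (lebesgue_measure \x lebesgueRn R s) (measurable_translate_pair v).
have mcA : measurable ((@cons_cV R s : measurableTypeR R * borelRn R s -> borelRn R s.+1) @^-1` A).
  by rewrite -[X in measurable X]setTI; apply: measurable_cons_cV.
have ccE p : translate v (@cons_cV R s p) = @cons_cV R s (translate_pair v p).
  case: p => x w; rewrite /translate /translate_pair /translate1/=.
  apply/colP => i; rewrite mxE; have [j ->|->] := unliftP ord0 i.
    by rewrite !cons_cVS/= !mxE.
  by rewrite !cons_cV0.
have cE : @cons_cV R s @^-1` (translate v @^-1` A) = translate_pair v @^-1` (@cons_cV R s @^-1` A).
  by apply/funext => p; rewrite /preimage /mkset ccE.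
rewrite [RHS](@product_measure_unique _ _ _ _ _ _ _ m')//; last first.
  move=> B C mB mC; rewrite /m'/= /pushforward.
  have -> : translate_pair v @^-1` (B `*` C) =
    (translate1 (v ord0 0%R) @^-1` B) `*` (translate (\col_i v (lift ord0 i) 0%R) @^-1` C).
    by [].
  rewrite product_measure1E.
  - by congr (_ * _); [exact: lebesgue_measure_translate1|exact: IH].
  - by rewrite -[X in measurable X]setTI; apply: measurable_translate1.
  - by rewrite -[X in measurable X]setTI; apply: measurable_translate.
exact: congr1.
Qed.

Lemma ge0_integral_translate s (v : 'cV[R]_s) (D : set (borelRn R s))
    (g : borelRn R s -> \bar R) : measurable D -> measurable_fun setT g ->
    (forall x, 0 <= g x) ->
  \int[lebesgueRn R s]_(x in translate v @^-1` D) g (translate v x) =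
  \int[lebesgueRn R s]_(x in D) g x.
Proof.
move=> mD mg g0.
pose m' : {measure set (borelRn R s) -> \bar R} :=
  measure_function_pushforward__canonical__measure_function_Measure
    (lebesgueRn R s) (measurable_translate v).
transitivity (\int[m']_(x in D) g x).
  apply/esym; apply: (ge0_integral_pushforward (measurable_translate v)) => //.
  exact: measurable_funS mg.
apply: (@eq_measure_integral _ _ _ D (lebesgueRn R s) m') => A mA _.
exact: lebesgueRn_translate.
Qed.

End borel.

(** * Integrals of second differences *)

Section integral_second_difference.
Context {R : realType} {s : nat}.
Local Open Scope ereal_scope.
Local Notation Leb := (lebesgueRn R s).

(** Balls of the sup norm are cubes, so [lebesgueRn_box] gives their volume. *)
Definition cbox (a : R) : set (borelRn R s) := [set x : 'cV[R]_s | (`|x| <= a)%R].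

Lemma measurable_cbox a : measurable (cbox a).
Proof.
apply: measurable_closed.
have -> : cbox a = Num.norm @^-1` [set x : R | (x <= a)%R] by [].
apply: preimage_closed; last exact: closed_le.
by move=> x _; exact: norm_continuous.
Qed.

Lemma lebesgueRn_cbox a : (0 <= a)%R -> Leb (cbox a) = ((2 * a) ^+ s)%:E.
Proof.
move=> a0; have := @lebesgueRn_box R s (const_mx (- a)%R) (const_mx a).
rewrite (_ : (\prod_i _)%R = ((2 * a) ^+ s)%R); last first.
  under eq_bigr do rewrite !mxE.
  by rewrite prodr_const card_ord; congr (_ ^+ _)%R; ring.
move=> <- => [|i]; last by rewrite !mxE ge0_cp.
congr (Leb _); apply/seteqP; split=> x /=.
  by move=> /(ler_mx_norm _ a0) H i; rewrite in_itv/= !mxE -ler_norml.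
move=> H; apply/(ler_mx_norm _ a0) => i j; rewrite ord1 ler_norml.
by have := H i; rewrite in_itv/= !mxE.
Qed.

Lemma integral_cbox_translate_le (g : borelRn R s -> \bar R) a (v : 'cV[R]_s) :
    measurable_fun setT g -> (forall x, 0 <= g x) ->
  \int[Leb]_(x in cbox a) g (translate v x) <= \int[Leb]_(x in cbox (a + `|v|)%R) g x.
Proof.
move=> mg g0; rewrite -(ge0_integral_translate v (measurable_cbox _) mg g0).
have ms := @measurable_translate R s v.
apply: ge0_subset_integral => //.
- exact: measurable_cbox.
- by rewrite -[X in measurable X]setTI; apply: ms => //; exact: measurable_cbox.
- by apply: measurable_funTS; exact: (measurableT_comp mg ms).
- by move=> x xa; apply: (le_trans (ler_normD (x : 'cV[R]_s) v)); rewrite lerD2r.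
Qed.

Variables (f : 'cV[R]_s -> R) (L : R).
Hypotheses (cf : jensen_convex f) (lf : lipschitz_with L f) (L0 : (0 < L)%R).

Lemma lipschitz_with_sdiff h : lipschitz_with (4 * L)%R (sdiff f h).
Proof.
move=> t u; have := sdiff_lipschitz h t u lf; have := sdiff_lipschitz h u t lf.
rewrite distrC ler_norml; lra.
Qed.

Lemma measurable_sdiff h :
  measurable_fun [set: borelRn R s] (fun t => (sdiff f h t)%:E).
Proof.
apply/measurable_EFinP; apply: lipschitz_with_measurable (lipschitz_with_sdiff h).
by rewrite mulr_gt0.
Qed.

Definition sdiff_integral h a := \int[Leb]_(t in cbox a) (sdiff f h t)%:E.

(** Integrate [sdiff_double]. The two shifted terms are integrals over translated cubes, which fit
    into the cube enlarged by the norm of [h]; the weights 1, 2, 1 add up to 4. *)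
Lemma sdiff_integral_double h a :
  sdiff_integral (h + h)%R a <= 4%:E * sdiff_integral h (a + `|h|)%R.
Proof.
have sd0 t : 0 <= (sdiff f h t)%:E by rewrite lee_fin sdiff_ge0.
have msd := measurable_sdiff h.
have msh v : measurable_fun [set: borelRn R s] (fun t => (sdiff f h (translate v t))%:E).
  exact: (measurableT_comp msd (measurable_translate v)).
rewrite /sdiff_integral.
under eq_integral do rewrite sdiff_double !EFinD.
have mc := measurable_cbox a.
rewrite ge0_integralD//=; last 4 first.
- by move=> t _; rewrite adde_ge0// -?EFinM ?lee_fin ?mulr_ge0 ?sdiff_ge0.
- apply: measurable_funTS; apply: emeasurable_funD; first exact: msh.
  by apply/measurable_EFinP; apply: measurable_funM => //; exact/measurable_EFinP.
- by move=> t _; rewrite lee_fin sdiff_ge0.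
- by apply: measurable_funTS; exact: msh.
rewrite ge0_integralD//=; last 4 first.
- by move=> t _; rewrite lee_fin sdiff_ge0.
- by apply: measurable_funTS; exact: msh.
- by move=> t _; rewrite -?EFinM ?lee_fin ?mulr_ge0 ?sdiff_ge0.
- apply: measurable_funTS; apply/measurable_EFinP; apply: measurable_funM => //.
  exact/measurable_EFinP.
under [X in _ + X + _]eq_integral do rewrite EFinM.
rewrite ge0_integralZl//; last first.
  by apply: measurable_funTS.
rewrite (_ : 4%:E = 1 + 2%:E + 1); last by rewrite -!EFinD; congr EFin; ring.
rewrite !ge0_muleDl ?adde_ge0//.
rewrite !mul1e; apply: leeD; first apply: leeD.
- exact: (@integral_cbox_translate_le (EFin \o sdiff f h)).
- rewrite lee_pmul2l ?lte_fin//; apply: ge0_subset_integral => //; try exact: measurable_cbox.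
    exact: measurable_funTS.
  by move=> t /= /le_trans; apply; rewrite lerDl.
- rewrite -(normrN h); exact: (@integral_cbox_translate_le (EFin \o sdiff f h)).
Qed.

Lemma sdiff_integral_le h a b : (a <= b)%R -> sdiff_integral h a <= sdiff_integral h b.
Proof.
move=> ab; apply: ge0_subset_integral.
- exact: measurable_cbox.
- exact: measurable_cbox.
- by apply: measurable_funTS; exact: measurable_sdiff.
- by move=> t _; rewrite lee_fin sdiff_ge0.
- by move=> t /= /le_trans; apply.
Qed.

(* Near a point where the second difference is at least [k |h|] it stays above
   half of that, by Lipschitz continuity. *)
Lemma sdiff_integral_kink_ge h (t0 : 'cV[R]_s) (k a d : R) : (0 < k)%R -> (0 < d)%R ->
    (`|t0| <= a)%R -> (d <= 2 * `|h|)%R -> (k * `|h| <= sdiff f h t0)%R ->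
  (k * d / 4 * (2 * Num.min d (k * d / (16 * L))) ^+ s)%:E <= sdiff_integral h (a + d)%R.
Proof.
(* The bound [d] keeps the small cube inside [cbox (a + d)]. The other bound limits the Lipschitz
   loss [4 L r] to [k d / 4], half of the lower bound [k d / 2] for [k |h|]. *)
move=> k0 d0 t0a dh kh; set r := Num.min _ _.
have r0 : (0 < r)%R by rewrite lt_min d0 divr_gt0 ?mulr_gt0.
have rd : (r <= d)%R by rewrite ge_min lexx.
have rk : (4 * L * r <= k * d / 4)%R.
  rewrite (_ : k * d / 4 = 4 * L * (k * d / (16 * L)))%R; last first.
    by field; rewrite gt_eqF.
  by rewrite ler_pM2l ?mulr_gt0// ge_min lexx orbT.
have mB : measurable (translate (- t0)%R @^-1` cbox r).
  by rewrite -[X in measurable X]setTI; apply: measurable_translate => //; exact: measurable_cbox.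
have -> : (k * d / 4 * (2 * r) ^+ s)%:E =
    \int[Leb]_(t in translate (- t0)%R @^-1` cbox r) (cst (k * d / 4)%:E t).
  rewrite integral_cst// EFinM; congr (_ * _).
  by rewrite [RHS]lebesgueRn_translate ?lebesgueRn_cbox ?ltW//; exact: measurable_cbox.
have kd0 : (0 <= k * d / 4)%R by rewrite divr_ge0// mulr_ge0 ?ltW.
apply: (@le_trans _ _ (\int[Leb]_(t in translate (- t0)%R @^-1` cbox r) (sdiff f h t)%:E)).
  apply: ge0_le_integral => //.
  - by apply: measurable_funTS; exact: measurable_sdiff.
  - move=> t /= tr; rewrite lee_fin.
    apply: le_trans (sdiff_lipschitz h t0 t lf); rewrite distrC.
    have H : (4 * L * `|(t : 'cV[R]_s) - t0| <= 4 * L * r)%R.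
      by rewrite ler_wpM2l// mulr_ge0// ltW.
    have : (k * d <= k * (2 * `|h|))%R by rewrite ler_pM2l.
    move: rk kh H; lra.
apply: ge0_subset_integral => //; first exact: measurable_cbox.
- by apply: measurable_funTS; exact: measurable_sdiff.
- by move=> t _; rewrite lee_fin sdiff_ge0.
- move=> t /= tr; rewrite -[t : 'cV[R]_s](subrK t0) addrC.
  apply: le_trans (ler_normD _ _) _; apply: lerD => //.
  exact: le_trans tr rd.
Qed.

(* Kinks at the macroscopic scale [d / 2 < |h| <= d] propagate to all smaller
   scales by doubling, with exactly quadratic loss. *)
Lemma sdiff_integral_ge_quadratic (k a d : R) : (0 < k)%R -> (0 < d)%R ->
    (forall h : 'cV[R]_s, exists2 t0 : 'cV[R]_s, (`|t0| <= a)%R & (k * `|h| <= sdiff f h t0)%R) ->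
  exists2 c, (0 < c)%R & forall h : 'cV[R]_s, (`|h| <= d)%R ->
    (c * `|h| ^+ 2)%:E <= sdiff_integral h (a + d + d)%R.
Proof.
move=> k0 d0 kink.
set C := (k * d / 4 * (2 * Num.min d (k * d / (16 * L))) ^+ s)%R.
have C0 : (0 < C)%R.
  apply: mulr_gt0; first by rewrite divr_gt0 ?mulr_gt0.
  by rewrite exprn_gt0// mulr_gt0// lt_min d0 divr_gt0 ?mulr_gt0.
have c0 : (0 < C / d ^+ 2)%R by rewrite divr_gt0// exprn_gt0.
exists (C / d ^+ 2)%R => // h hd.
have [->|h0] := eqVneq h 0%R.
  rewrite normr0 expr0n/= mulr0; apply: integral_ge0 => t _.
  by rewrite lee_fin sdiff_ge0.
have hpos : (0 < `|h|)%R by rewrite normr_gt0.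
(* Macroscopic scale: the kink bound gives [C], and [|g| <= d] makes both the quadratic term at most
   [C] and the cube large enough. *)
have base (g : 'cV[R]_s) : (d <= 2 * `|g|)%R -> (`|g| <= d)%R ->
    (C / d ^+ 2 * `|g| ^+ 2)%:E <= sdiff_integral g (a + d + d - `|g|)%R.
  move=> dg gd; have [t0 t0a kg] := kink g.
  apply: (@le_trans _ _ C%:E).
    rewrite lee_fin mulrAC ler_pdivrMr ?exprn_gt0// ler_pM2l//.
    by rewrite lerXn2r// nnegrE// ltW.
  apply: le_trans (sdiff_integral_kink_ge k0 d0 t0a dg kg) _.
  by apply: sdiff_integral_le; rewrite -addrA lerDl subr_ge0.
(* The radius [a + 2 d - |g|] is invariant under the induction: passing from [g + g] to [g] enlarges
   the cube by exactly [|g|]. All enlargements together thus stay below [a + 2 d]. *)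
have key n : forall g : 'cV[R]_s, (d < 2 ^+ n.+1 * `|g|)%R -> (`|g| <= d)%R ->
    (C / d ^+ 2 * `|g| ^+ 2)%:E <= sdiff_integral g (a + d + d - `|g|)%R.
  elim: n => [|n IH] g dg gd; first by apply: base => //; exact: ltW.
  have [g2|/ltW g2] := leP (2 * `|g|)%R d; last exact: base.
  have gg : `|g + g|%R = (2 * `|g|)%R.
    by rewrite -mulr2n normrMn mulr_natl.
  have := IH (g + g)%R; rewrite gg => /(_ _ g2) H.
  have : (C / d ^+ 2 * (2 * `|g|) ^+ 2)%:E <= 4%:E * sdiff_integral g (a + d + d - `|g|)%R.
    apply: le_trans (H _) _; first by rewrite mulrA -exprSr.
    apply: le_trans (sdiff_integral_double _ _) _.
    by rewrite (_ : a + d + d - 2 * `|g| + `|g| = a + d + d - `|g|)%R//; ring.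
  rewrite (_ : (C / d ^+ 2 * (2 * `|g|) ^+ 2)%R = (4 * (C / d ^+ 2 * `|g| ^+ 2))%R); last by ring.
  by rewrite EFinM lee_pmul2l.
have [n hn] : exists n, (d < 2 ^+ n.+1 * `|h|)%R.
  have := archi_boundP (ltW (divr_gt0 d0 hpos)); set n := Num.bound _ => dn.
  exists n; rewrite -ltr_pdivrMr//; apply: lt_le_trans dn _.
  by rewrite -natrX ler_nat ltnW// ltnW// ltn_expl.
apply: le_trans (key n h hn hd) _.
by apply: sdiff_integral_le; rewrite lerBlDr lerDl.
Qed.

End integral_second_difference.

(** * Expectations *)

Section measure_comparison.
Context d {T : measurableType d} {R : realType}.
Local Open Scope ereal_scope.

Lemma ge0_integral_minorized (mu nu : {measure set T -> \bar R}) (B : set T)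
    (r : R) (g : T -> \bar R) :
    measurable B -> (0 < r)%R ->
    (forall A, measurable A -> A `<=` B -> r%:E * nu A <= mu A) ->
    measurable_fun setT g -> (forall x, 0 <= g x) ->
  r%:E * \int[nu]_(x in B) g x <= \int[mu]_(x in B) g x.
Proof.
move=> mB r0 numu mg g0.
pose k : {nonneg R} := NngNum (ltW r0).
(* Restricting to [B] makes the domination by [mu] hold on every measurable set, not only on subsets
   of [B]. *)
pose nu' : {measure set T -> \bar R} := mrestr (mscale k nu) mB.
rewrite -[r]/(k%:num) -ge0_integral_mscale//; last exact: measurable_funS mg.
rewrite (@eq_measure_integral _ _ _ B nu' (mscale k nu)); last first.
  by move=> A mA AB; rewrite /nu'/= /mrestr setIidl.
apply: ge0_le_measure_integral => // A mA.
rewrite /nu' /= /mrestr /= /mscale /=.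
apply: le_trans (numu _ _ _) _; first exact: measurableI.
  exact: subIsetr.
by apply: le_measure; rewrite ?inE//; exact: measurableI.
Qed.

End measure_comparison.

Section gap.
Context {R : realType} {s : nat}.
Local Open Scope ereal_scope.
Local Notation Leb := (lebesgueRn R s).
Variables (f : 'cV[R]_s -> R) (L : R).
Hypotheses (cf : jensen_convex f) (lf : lipschitz_with L f) (L0 : (0 < L)%R).

(** For [h = x' - x] and [t = z - (la x' + (1 - la) x)] the two outer points are [z - x'] and
    [z - x]. The integral over [z] is then the Jensen deficit of the expectation. *)
Definition convexity_gap (la : R) (h t : 'cV[R]_s) : R :=
  (la * f (t - (1 - la) *: h) + (1 - la) * f (t + la *: h) - f t)%R.

Lemma convexity_gap_ge0 la h t : (0 <= la <= 1)%R -> (0 <= convexity_gap la h t)%R.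
Proof.
move=> la01; rewrite /convexity_gap subr_ge0.
have := cf (t - (1 - la) *: h)%R (t + la *: h)%R la01.
by congr (f _ <= _)%R; apply/colP => i; rewrite !mxE; ring.
Qed.

Lemma measurable_f_add (v : 'cV[R]_s) :
  measurable_fun [set: borelRn R s] (fun t : borelRn R s => f ((t : 'cV[R]_s) + v)%R).
Proof.
exact: (measurableT_comp (lipschitz_with_measurable L0 lf) (measurable_translate v)).
Qed.

Lemma measurable_convexity_gap la h :
  measurable_fun [set: borelRn R s] (convexity_gap la h : borelRn R s -> R).
Proof.
apply: measurable_funB; last exact: (lipschitz_with_measurable L0 lf).
by apply: measurable_funD; apply: measurable_funM => //; exact: measurable_f_add.
Qed.

(** Integrates [convexity_gap_ge]. The second difference there is centred at [t - al *: h], and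
    undoing this shift enlarges the cube by at most [d]. *)
Lemma integral_convexity_gap_ge (c d b : R) :
    (forall h : 'cV[R]_s, (`|h| <= d)%R -> (c * `|h| ^+ 2)%:E <= sdiff_integral f h b) ->
  forall (la al : R) (h : 'cV[R]_s), (0 <= la)%R -> (la <= 1 / 2)%R ->
    (0 < al)%R -> (al <= 1 / 4)%R -> (al * `|h| <= d)%R ->
  (la * (1 - la) / (2 * al) * (c * (al * `|h|) ^+ 2))%:E <=
    \int[Leb]_(t in cbox (b + d)%R) (convexity_gap la h t)%:E.
Proof.
move=> H la al h la0 la2 al0 al4 ald.
have la1 : (la <= 1)%R by lra.
have alh : (`|al *: h| = al * `|h|)%R by rewrite normrZ ger0_norm// ltW.
set C := (la * (1 - la) / (2 * al))%R.
have C0 : (0 <= C)%R by rewrite divr_ge0 ?mulr_ge0 ?subr_ge0// ltW.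
pose g (t : borelRn R s) := (sdiff f (al *: h) (translate (- (al *: h))%R t))%:E.
have g0 t : 0 <= g t by rewrite lee_fin sdiff_ge0.
have mg : measurable_fun setT g.
  exact: (measurableT_comp (measurable_sdiff lf L0 (al *: h)) (measurable_translate _)).
have mc := @measurable_cbox R s (b + d)%R.
rewrite EFinM; apply: (@le_trans _ _ (C%:E * \int[Leb]_(t in cbox (b + d)%R) g t)).
  apply: lee_wpmul2l; first by rewrite lee_fin.
  rewrite -alh; apply: le_trans (H _ _) _; first by rewrite alh.
  apply: (@le_trans _ _ (\int[Leb]_(t in cbox (b + `|al *: h|)%R) g t)).
    apply: le_trans (integral_cbox_translate_le _ (al *: h) mg g0).
    rewrite /sdiff_integral le_eqVlt; apply/orP; left; apply/eqP; apply: eq_integral => t _.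
    by rewrite /g /translate addrK.
  apply: ge0_subset_integral => //; first exact: measurable_cbox.
    exact: measurable_funTS.
  by move=> t ta; apply: (le_trans ta); rewrite lerD2l alh.
rewrite -ge0_integralZl//; last exact: measurable_funTS.
apply: ge0_le_integral => //.
- by move=> t _; rewrite mule_ge0.
- by apply: measurable_funTS; exact: measurable_funeM.
- by apply: measurable_funTS; apply/measurable_EFinP; exact: measurable_convexity_gap.
- by move=> t _; rewrite /g -EFinM lee_fin convexity_gap_ge.
Qed.

End gap.

Section expectation.
Context {R : realType} {s : nat}.
Local Open Scope ereal_scope.
Local Notation Leb := (lebesgueRn R s).
Variable mu : probability (borelRn R s) R.
Hypothesis A3 : \int[mu]_z (enorm (z : 'cV[R]_s))%:E < +oo.

Lemma measurable_enorm :
  measurable_fun [set: borelRn R s] (@enorm R s : borelRn R s -> R).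
Proof.
apply: (@measurableT_comp _ _ _ _ _ _ (@Num.sqrt R)).
  by apply: measurable_realfun.continuous_measurable_fun; exact: sqrt_continuous.
apply: measurable_sum => i; apply: measurable_funX; exact: measurable_coord.
Qed.

Lemma measurable_normr :
  measurable_fun [set: borelRn R s] (fun z : borelRn R s => `|z : 'cV[R]_s|%R).
Proof. by apply: continuous_measurable => x; exact: norm_continuous. Qed.

Lemma measurable_EFin_normr :
  measurable_fun [set: borelRn R s] (fun z : borelRn R s => (`|z : 'cV[R]_s|%R)%:E).
Proof. by apply/measurable_EFinP; exact: measurable_normr. Qed.

Lemma integrable_norm :
  mu.-integrable setT (fun z : borelRn R s => (`|z : 'cV[R]_s|%R)%:E).
Proof.
apply/integrableP; split; first exact: measurable_EFin_normr.
apply: le_lt_trans A3; apply: ge0_le_integral => //.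
- by apply: measurableT_comp => //; exact: measurable_EFin_normr.
- by apply/measurable_EFinP; exact: measurable_enorm.
- by move=> z _; rewrite /= lee_fin normr_id norm_le_enorm.
Qed.

(** A Lipschitz function grows at most linearly, and the first moment is finite. *)
Lemma lipschitz_with_integrable (f : 'cV[R]_s -> R) L (x : 'cV[R]_s) :
    (0 < L)%R -> lipschitz_with L f ->
  mu.-integrable setT (fun z : borelRn R s => (f ((z : 'cV[R]_s) - x)%R)%:E).
Proof.
move=> L0 lf.
pose b (z : borelRn R s) : R := (`|f (- x)%R| + L * `|z : 'cV[R]_s|)%R.
have ib : mu.-integrable setT (EFin \o b).
  have -> : EFin \o b = (EFin \o cst `|f (- x)%R|%R) \+
      (fun z : borelRn R s => L%:E * (`|z : 'cV[R]_s|%R)%:E).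
    by apply/funext => z; rewrite /b /= EFinD EFinM.
  apply: integrableD => //; first exact: finite_measure_integrable_cst.
  by apply: integrableZl => //; exact: integrable_norm.
apply: le_integrable ib => //.
  by apply/measurable_EFinP; exact: (measurable_f_add lf L0).
move=> z _; rewrite /= lee_fin /b [leRHS]ger0_norm; last first.
  by rewrite addr_ge0// mulr_ge0// ltW.
rewrite -[f _](subrK (f (- x)%R)) addrC.
apply: le_trans (ler_normD _ _) _; rewrite lerD2l.
by apply: le_trans (lf _ _) _; rewrite opprK subrK.
Qed.

Variables (V : set 'cV[R]_s) (r rho1 : R).
Hypothesis convexV : convex_set V.
Hypotheses (r0 : (0 < r)%R) (rho10 : (0 < rho1)%R).

Definition ccube (x : 'cV[R]_s) : set (borelRn R s) :=
  translate (- x)%R @^-1` cbox rho1.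

Lemma measurable_ccube x : measurable (ccube x).
Proof.
by rewrite -[X in measurable X]setTI; apply: measurable_translate => //; exact: measurable_cbox.
Qed.

Hypothesis mu_ge_Leb : forall x A, V x -> measurable A -> A `<=` ccube x ->
  r%:E * Leb A <= mu A.

(* Every cube centred in [V] has mass at least [r (2 rho1)^s], so a far away
   point of [V] would contradict the finite first moment. *)
Lemma minorized_bounded : exists2 H, (0 < H)%R & forall x, V x -> (`|x| <= H)%R.
Proof.
pose K := fine (\int[mu]_z (`|z : 'cV[R]_s|%R)%:E).
have KE : K%:E = \int[mu]_z (`|z : 'cV[R]_s|%R)%:E.
  by rewrite fineK//; exact: integrable_fin_num integrable_norm.
have K0 : (0 <= K)%R by apply: fine_ge0; apply: integral_ge0 => z _; rewrite lee_fin.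
pose m := (r * (2 * rho1) ^+ s)%R.
have m0 : (0 < m)%R by rewrite mulr_gt0// exprn_gt0// mulr_gt0.
(* On the cube around [x] one has [|z| >= |x| - rho1], and its mass is at least [m]; hence
   [(|x| - rho1) m <= K]. *)
exists (rho1 + K / m)%R; first by rewrite ltr_pwDl// divr_ge0// ltW.
move=> x Vx; have [xr|xr] := leP `|x|%R rho1.
  by apply: le_trans xr _; rewrite lerDl divr_ge0// ltW.
rewrite -lerBlDl ler_pdivlMr// -lee_fin KE.
have mx := measurable_ccube x.
apply: (@le_trans _ _ ((`|x| - rho1)%:E * mu (ccube x))).
  rewrite EFinM; apply: lee_wpmul2l; first by rewrite lee_fin subr_ge0 ltW.
  apply: le_trans (mu_ge_Leb Vx mx _) => //.
  rewrite [X in _ * X]lebesgueRn_translate ?lebesgueRn_cbox ?(ltW rho10)//.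
  exact: measurable_cbox.
rewrite -integral_cst//.
apply: (@le_trans _ _ (\int[mu]_(z in ccube x) (`|z : 'cV[R]_s|%R)%:E)).
  apply: ge0_le_integral => //.
  - by move=> z _; rewrite lee_fin subr_ge0 ltW.
  - by apply: measurable_funTS; exact: measurable_EFin_normr.
  - move=> z zx; rewrite lee_fin lerBlDr -lerBlDl.
    apply: le_trans (lerB_dist _ _) _; rewrite distrC; exact: zx.
apply: ge0_subset_integral => //.
exact: measurable_EFin_normr.
Qed.

Lemma expectation_strongly_convex (f : 'cV[R]_s -> R) (L c d b : R) :
    (0 < L)%R -> jensen_convex f -> lipschitz_with L f ->
    (0 < c)%R -> (0 < d)%R -> (b + d <= rho1)%R ->
    (forall h : 'cV[R]_s, (`|h| <= d)%R -> (c * `|h| ^+ 2)%:E <= sdiff_integral f h b) ->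
  strongly_convex V (fun x => (\int[mu]_z f ((z : 'cV[R]_s) - x))%R).
Proof.
move=> L0 cf lf c0 d0 bd Hc.
have [H H0 VH] := minorized_bounded.
(* Since [|x' - x| <= 2 H] on [V], this makes [al |x' - x| <= d] uniformly; 1/4 is the limit
   required by [convexity_gap_ge]. *)
pose al := (Num.min (1 / 4) (d / (2 * H)))%R.
have al0 : (0 < al)%R by rewrite lt_min !divr_gt0// mulr_gt0.
have al4 : (al <= 1 / 4)%R by rewrite ge_min lexx.
have alH : (al * (2 * H) <= d)%R by rewrite -ler_pdivlMr ?mulr_gt0// ge_min lexx orbT.
(* The factor [s.+1] converts the sup norm to the Euclidean one and is nonzero also in dimension
   0. *)
exists (r * c * al / s.+1%:R)%R; split; first by rewrite divr_gt0 ?mulr_gt0.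
move=> x x' la.
(* Exchanging [x] with [x'] and [la] with [1 - la] leaves the inequality unchanged. *)
wlog la2 : x x' la / (la <= 1 / 2)%R => [wl Vx Vx' la01|].
  have [la2|la2] := leP la (1 / 2)%R; first exact: wl.
  have en : enorm (x - x')%R = enorm (x' - x)%R.
    rewrite /enorm; congr Num.sqrt; apply: eq_bigr => i _.
    by rewrite !mxE -sqrrN opprB.
  have lc : (1 - la <= 1 / 2)%R by lra.
  have lc01 : (0 <= 1 - la <= 1)%R by move: la01; lra.
  have := wl x' x (1 - la)%R lc Vx' Vx lc01; rewrite subKr en.
  rewrite [((1 - la) *: x + _)%R]addrC => /le_trans; apply.
  by rewrite le_eqVlt; apply/orP; left; apply/eqP; ring.
move=> Vx Vx' /andP[la0 la1].
set h := (x' - x)%R; set xl := (la *: x' + (1 - la) *: x)%R.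
have Vxl : V xl.
  by have := convexV (Itv01 la0 la1) (mem_set Vx') (mem_set Vx); rewrite inE.
have hH : (al * `|h| <= d)%R.
  apply: le_trans alH; rewrite ler_pM2l//; apply: le_trans (ler_normB _ _) _.
  by rewrite mulr2n mulrDl mul1r lerD// VH.
have I y : mu.-integrable setT (fun z : borelRn R s => (f ((z : 'cV[R]_s) - y)%R)%:E).
  exact: lipschitz_with_integrable L0 lf.
pose g := convexity_gap f la h.
have g0 t : (0 <= g t)%R by apply: convexity_gap_ge0 => //; rewrite la0.
have mg : measurable_fun [set: borelRn R s] (fun t : borelRn R s => (g t)%:E).
  by apply/measurable_EFinP; exact: (measurable_convexity_gap lf L0).
have gE (z : borelRn R s) : g (translate (- xl)%R z) =
    (la * f ((z : 'cV[R]_s) - x') + (1 - la) * f ((z : 'cV[R]_s) - x) - f ((z : 'cV[R]_s) - xl))%R.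
  by rewrite /g /convexity_gap /translate; congr (_ * f _ + _ * f _ - _)%R;
    apply/colP => i; rewrite !mxE; ring.
(* The integrand is nonnegative, so it may be restricted to the cube around [xl], which lies in [V].
   There [mu] dominates [r] times Lebesgue measure, and a translation centres the cube at the
   origin. *)
have lower : (r * (la * (1 - la) / (2 * al) * (c * (al * `|h|) ^+ 2)))%:E <=
    \int[mu]_z (g (translate (- xl)%R z))%:E.
  have mgt : measurable_fun [set: borelRn R s] (fun z => (g (translate (- xl)%R z))%:E).
    exact: (measurableT_comp mg (measurable_translate _)).
  apply: (@le_trans _ _ (\int[mu]_(z in ccube xl) (g (translate (- xl)%R z))%:E)); last first.
    apply: ge0_subset_integral => //; first exact: measurable_ccube.
    by move=> z _; rewrite lee_fin.
  apply: le_trans (ge0_integral_minorized _ r0 (fun A mA => mu_ge_Leb Vxl mA) mgt _); last 2 first.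
  - exact: measurable_ccube.
  - by move=> z; rewrite lee_fin.
  rewrite EFinM; apply: lee_wpmul2l; first by rewrite lee_fin ltW.
  rewrite (@ge0_integral_translate R s (- xl)%R (cbox rho1) (fun t => (g t)%:E))//; first last.
  - exact: measurable_cbox.
  apply: le_trans (integral_convexity_gap_ge cf lf L0 Hc la0 la2 al0 al4 hH) _.
  apply: ge0_subset_integral => //; try exact: measurable_cbox.
  - exact: measurable_funTS.
  - by move=> t _; rewrite lee_fin; exact: g0.
  - by move=> t /le_trans; apply.
have EE : \int[mu]_z (g (translate (- xl)%R z))%:E =
    (la * (\int[mu]_z f ((z : 'cV[R]_s) - x')) + (1 - la) * (\int[mu]_z f ((z : 'cV[R]_s) - x))
      - \int[mu]_z f ((z : 'cV[R]_s) - xl))%R%:E.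
  have IZ k y : mu.-integrable setT (EFin \o (fun z : borelRn R s => k * f ((z : 'cV[R]_s) - y))%R).
    rewrite (_ : _ \o _ = fun z : borelRn R s => k%:E * (f ((z : 'cV[R]_s) - y)%R)%:E).
      exact: integrableZl.
    by apply/funext => z /=; rewrite EFinM.
  have ID k y k' y' : mu.-integrable setT (EFin \o (fun z : borelRn R s =>
      k * f ((z : 'cV[R]_s) - y) + k' * f ((z : 'cV[R]_s) - y'))%R).
    rewrite (_ : _ \o _ = (EFin \o (fun z : borelRn R s => k * f ((z : 'cV[R]_s) - y))%R) \+
       (EFin \o (fun z : borelRn R s => k' * f ((z : 'cV[R]_s) - y'))%R)).
      exact: integrableD.
    by apply/funext => z /=; rewrite EFinD.
  have EZ k y : (k * (\int[mu]_z f ((z : 'cV[R]_s) - y)) =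
      \int[mu]_z (k * f ((z : 'cV[R]_s) - y)))%R.
    by rewrite RintegralZl//; exact: I.
  rewrite !EZ -(RintegralD measurableT (IZ _ _) (IZ _ _)).
  rewrite -(RintegralB measurableT (ID _ _ _ _) (I xl)).
  rewrite /Rintegral fineK.
    by apply: eq_integral => z _; rewrite gE.
  apply: integrable_fin_num => //.
  rewrite (_ : (fun _ => _) = (EFin \o (fun z : borelRn R s =>
      la * f ((z : 'cV[R]_s) - x') + (1 - la) * f ((z : 'cV[R]_s) - x))%R) \-
       (fun z : borelRn R s => (f ((z : 'cV[R]_s) - xl)%R)%:E)).
    exact: integrableB.
  by apply/funext => z /=; rewrite EFinB.
rewrite EE lee_fin in lower.
rewrite lerBrDl -lerBrDr; apply: le_trans lower.
have hs := enorm_sqr_le h.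
have sh : (enorm h ^+ 2 / s.+1%:R <= `|h| ^+ 2)%R.
  rewrite ler_pdivrMr// mulrC; apply: le_trans hs _.
  by rewrite ler_wpM2r ?exprn_ge0// ler_nat.
rewrite (_ : (r * (la * (1 - la) / (2 * al) * (c * (al * `|h|) ^+ 2)) =
  r * c * al / 2 * (la * (1 - la)) * `|h| ^+ 2)%R); last first.
  by field; rewrite gt_eqF.
rewrite (_ : (r * c * al / s.+1%:R / 2 * la * (1 - la) * enorm h ^+ 2 =
  r * c * al / 2 * (la * (1 - la)) * (enorm h ^+ 2 / s.+1%:R))%R); last by ring.
apply: ler_wpM2l => //.
apply: mulr_ge0; last by rewrite mulr_ge0// subr_ge0.
by rewrite divr_ge0// !mulr_ge0// ltW.
Qed.

End expectation.

(** * Minorization by the density, and conclusion *)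

Lemma enorm_lt (R : realType) s (u : 'cV[R]_s) (rho : R) : 0 < rho ->
  `|u| <= rho / s.+1%:R -> enorm u < rho.
Proof.
move=> rho0 ur; rewrite -(ltr_pXn2r (n := 2))// ?nnegrE ?sqrtr_ge0// ?(ltW rho0)//.
apply: le_lt_trans (enorm_sqr_le u) _.
apply: (@le_lt_trans _ _ (s%:R * (rho / s.+1%:R) ^+ 2)).
  by apply: ler_wpM2l => //; apply: lerXn2r => //; rewrite nnegrE//;
    apply: divr_ge0 => //; exact: ltW.
rewrite expr_div_n mulrCA -ltr_pdivlMl ?exprn_gt0// mulVf ?gt_eqF ?exprn_gt0//.
(* It remains to see that [s < (s + 1)^2]. *)
rewrite ltr_pdivrMr ?exprn_gt0// mul1r -natrX ltr_nat.
by apply: (leq_trans (ltnSn s)); rewrite -[X in (X <= _)%N]expn1 leq_pexp2l.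
Qed.

(** The cube of radius [rho / s.+1] around a point of [V] lies in the Euclidean ball of radius [rho]
    there, where the density is almost everywhere at least [r]. *)
Lemma density_minoration (R : realType) (s : nat) (mu : probability (borelRn R s) R)
    (theta : borelRn R s -> R) (V : set 'cV[R]_s) (r rho : R) :
    has_density mu theta -> 0 < r -> 0 < rho ->
    {ae lebesgueRn R s, forall z : borelRn R s,
      [set v + u | v in V & u in eball0 rho] z -> r <= theta z} ->
  forall x A, V x -> measurable A -> A `<=` ccube (rho / s.+1%:R) x ->
  (r%:E * lebesgueRn R s A <= mu A)%E.
Proof.
move=> [mtheta theta0 muE] r0 rho0 aer x A Vx mA Ax.
rewrite muE// -integral_cst//; apply: ae_ge0_le_integral => //.
- by move=> z _; rewrite lee_fin ltW.
- by move=> z _; rewrite lee_fin.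
- by apply: measurable_funTS; exact/measurable_EFinP.
- apply: filterS aer => z H Az; rewrite lee_fin; apply: H.
  exists x => //; exists ((z : 'cV[R]_s) - x); last by rewrite addrC subrK.
  by apply: enorm_lt => //; exact: Ax.
Qed.

Theorem theorem3p5 (R : realType) (s m : nat) (W : 'M[R]_(s, m)) (q : 'cV[R]_m)
    (mu : probability (borelRn R s) R)
    (A1 : forall t : 'cV[R]_s,
      exists y : 'cV[R]_m, (forall j, 0 <= y j 0) /\ W *m y = t)
    (A2 : exists xi : 'cV[R]_s, forall j, (W^T *m xi) j 0 < q j 0)
    (A3 : (\int[mu]_z (enorm (z : 'cV[R]_s))%:E < +oo)%E)
    (theta : borelRn R s -> R) (V : set 'cV[R]_s) (r rho : R)
    (A4_density : has_density mu theta)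
    (A4_convex : convex_set V)
    (A4_open : open V)
    (A4_r : 0 < r)
    (A4_rho : 0 < rho)
    (A4_bound : {ae lebesgueRn R s, forall z : borelRn R s,
      [set v + u | v in V & u in eball0 rho] z -> r <= theta z})
    (A5 : forall x : 'cV[R]_s,
      mu [set z : 'cV[R]_s | phi q W (z - x) = 0] = 0%E) :
  exists c : R, 0 < c /\
    forall eta : R, eta < c -> strongly_convex V (expected_excess q W mu eta).
Proof.
have [L L0 phiL] := phi_Lipschitz A1 A2.
have [k k0 phik] := phi_opp_ge A1 A2.
pose rho1 := rho / s.+1%:R.
have rho10 : 0 < rho1 by rewrite divr_gt0.
(* Below this threshold the kink, at distance at most [max(eta, 0) / k], lies strictly inside the
   cube of radius [rho1]. *)
exists (k * rho1); split=> [|eta etac]; first exact: mulr_gt0.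
pose f t := Num.max eta (phi q W t).
have cf : jensen_convex f by apply: jensen_convex_max => x y a; exact: phi_convex.
have lf : lipschitz_with L f by exact: lipschitz_with_max.
pose a := Num.max eta 0 / k.
have arho : a < rho1 by rewrite ltr_pdivrMr// mulrC gt_max etac mulr_gt0.
(* The margin [rho1 - a] is spent in three equal parts: two in the radius [a + d + d] of
   [sdiff_integral_ge_quadratic], one in the shift of [integral_convexity_gap_ge]. *)
pose d := (rho1 - a) / 3.
have d0 : 0 < d by rewrite divr_gt0// subr_gt0.
have kink h : exists2 t0 : 'cV[R]_s, `|t0| <= a & k * `|h| <= sdiff f h t0.
  by apply: truncation_kink => //; [exact: phi0|move=> *; exact: phiZ].
have [c c0 Hc] := sdiff_integral_ge_quadratic cf lf L0 k0 d0 kink.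
apply: (expectation_strongly_convex A3 A4_convex A4_r rho10 _ L0 cf lf c0 d0 _ Hc).
  exact: density_minoration A4_density A4_r A4_rho A4_bound.
by rewrite /d; lra.
Qed.
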